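(* Let $\boldsymbol{f}\in\boldsymbol{V}_h^*$ and let $(\boldsymbol{u}_h,\boldsymbol{j}_h,\boldsymbol{\sigma}_h,\boldsymbol{B}_h,p_h,r_h)\in\boldsymbol{X}_h\times\boldsymbol{Y}_h$ satisfy, for all $(\boldsymbol{v}_h,\boldsymbol{k}_h,\boldsymbol{\tau}_h,\boldsymbol{C}_h,q_h,s_h)\in\boldsymbol{X}_h\times\boldsymbol{Y}_h$, $$\begin{aligned} &R_e^{-1}(\nabla\boldsymbol{u}_h,\nabla\boldsymbol{v}_h)+L(\boldsymbol{u}_h;\boldsymbol{u}_h,\boldsymbol{v}_h)+S(\boldsymbol{j}_h,\boldsymbol{v}_h\times\boldsymbol{B}_h)-(p_h,\nabla\cdot\boldsymbol{v}_h)=\langle\boldsymbol{f},\boldsymbol{v}_h\rangle,\\ &SR_m^{-1}(\nabla\times\boldsymbol{j}_h,\boldsymbol{C}_h)-SR_m^{-1}(\nabla\times\boldsymbol{\sigma}_h,\boldsymbol{C}_h)+(r_h,\nabla\cdot\boldsymbol{C}_h)=0,\\ &SR_m^{-1}(\boldsymbol{\sigma}_h,\boldsymbol{\tau}_h)-SR_m^{-1}(\boldsymbol{u}_h\times\boldsymbol{B}_h,\boldsymbol{\tau}_h)=0,\\ &S(\boldsymbol{j}_h,\boldsymbol{k}_h)-SR_m^{-1}(\boldsymbol{B}_h,\nabla\times\boldsymbol{k}_h)=0,\\ &-(\nabla\cdot\boldsymbol{u}_h,q_h)=0,\qquad(\nabla\cdot\boldsymbol{B}_h,s_h)=0. \end{aligned}$$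 Then: (1) $\nabla\cdot\boldsymbol{B}_h=0$ in the strong sense. (2) $r_h=0$, and hence the second equation reduces to $\nabla\times(\boldsymbol{j}_h-\boldsymbol{\sigma}_h)=\boldsymbol{0}$. (3) The energy estimates hold: $$R_e^{-1}\|\nabla\boldsymbol{u}_h\|^2+S\|\boldsymbol{j}_h\|^2=\langle\boldsymbol{f},\boldsymbol{u}_h\rangle,\qquad \frac{1}{2R_e}\|\nabla\boldsymbol{u}_h\|^2+S\|\boldsymbol{j}_h\|^2\le\frac{R_e}{2}\|\boldsymbol{f}\|_{-1}^2.$$
   Context: $\Omega\subset\mathbb{R}^3$ is a bounded contractible Lipschitz polyhedron; $R_e,R_m,S>0$ are constants. $(\cdot,\cdot)$ and $\|\cdot\|$ are the $L^2(\Omega)$ inner product and norm. $H_0(\mathrm{curl},\Omega)$ and $H_0(\mathrm{div},\Omega)$ are the usual spaces with vanishing tangential, respectively normal, trace; $L^2_0(\Omega)$ is the space of mean-zero $L^2$ functions. On a regular quasi-uniform (tetrahedral) triangulation of $\Omega$ with mesh size $h$, the finite element spaces $H_0^h(\mathrm{grad},\Omega)\subset H^1_0(\Omega)$, $H_0^h(\mathrm{curl},\Omega)\subset H_0(\mathrm{curl},\Omega)$, $H_0^h(\mathrm{div},\Omega)\subset H_0(\mathrm{div},\Omega)$, $L^2_{0,h}(\Omega)\subset L^2_0(\Omega)$ belong to one finite element de Rham sequence (Lagrange, Nédélec edge elements of first or second kind, Raviart–Thomas or BDM face elements, discontinuous piecewise polynomials); grad, curl, div map each space into the next, the sequence is exact,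 and $\nabla\cdot H_0^h(\mathrm{div},\Omega)=L^2_{0,h}(\Omega)$. $\boldsymbol{V}_h\subset H_0^1(\Omega)^3$ and $Q_h\subset L^2_0(\Omega)$ are a stable finite element pair for the Stokes problem (velocity, pressure). $\boldsymbol{X}_h:=\boldsymbol{V}_h\times H_0^h(\mathrm{curl},\Omega)\times H_0^h(\mathrm{curl},\Omega)\times H_0^h(\mathrm{div},\Omega)$ and $\boldsymbol{Y}_h:=Q_h\times L^2_{0,h}(\Omega)$. $L(\boldsymbol{w};\boldsymbol{u},\boldsymbol{v}):=\frac12[((\boldsymbol{w}\cdot\nabla)\boldsymbol{u},\boldsymbol{v})-((\boldsymbol{w}\cdot\nabla)\boldsymbol{v},\boldsymbol{u})]$. For $\boldsymbol{f}\in\boldsymbol{V}_h^*$, $\|\boldsymbol{f}\|_{-1}:=\sup_{0\ne\boldsymbol{v}\in\boldsymbol{V}_h}\langle\boldsymbol{f},\boldsymbol{v}\rangle/\|\nabla\boldsymbol{v}\|$. *)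

(* Defs.v *)
From HB Require Import structures.
From mathcomp Require Import all_boot all_order all_algebra.
From mathcomp Require Import all_classical all_reals all_analysis.

Set Implicit Arguments.
Unset Strict Implicit.
Unset Printing Implicit Defensive.

Import Order.TTheory GRing.Theory Num.Theory.
Import numFieldNormedType.Exports.

Local Open Scope classical_set_scope.
Local Open Scope ring_scope.

(* Points of R^3 are triples, which carry the library's product topology and
   product Lebesgue measure; vectors (the values of fields) are row vectors.
   Indices in 'I_3 = 'Z_3 are added modulo 3, so that i, i + 1, i + 2 is always
   a cyclic permutation of the axes.
   Elements of L^2(Omega) and of its subspaces are represented by functions on
   the whole of R^3; what matters is their class modulo equality almost
   everywhere in Omega, and equality of two such elements is always written
   f = g %[ae leb3 in Omega]. *)

Notation sfield R := ((R * R * R)%type -> R) (only parsing).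
Notation vfield R := ((R * R * R)%type -> 'rV[R]_3) (only parsing).

Section VectorCalculus.
Context {R : realType}.

Definition leb3 : {measure set (measurableTypeR R * measurableTypeR R
    * measurableTypeR R)%type -> \bar R} :=
  ((@lebesgue_measure R \x @lebesgue_measure R) \x @lebesgue_measure R)%E.

Definition coords (x : R * R * R) : 'rV[R]_3 :=
  \row_i [:: x.1.1; x.1.2; x.2]`_i.
Definition axis (i : 'I_3) : R * R * R :=
  ((i == 0)%:R, (i == 1)%:R, (i == 2)%:R).

Definition cpt (i : 'I_3) (u : vfield R) : sfield R := fun x => u x 0 i.

Definition mxdot m n (A B : 'M[R]_(m, n)) : R := \sum_i \sum_j A i j * B i j.
Definition enorm (v : 'rV[R]_3) : R := Num.sqrt (mxdot v v).
Definition cross (u v : 'rV[R]_3) : 'rV[R]_3 :=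
  \row_i (u 0 (i + 1) * v 0 (i + 2) - u 0 (i + 2) * v 0 (i + 1)).
Definition fcross (u v : vfield R) : vfield R := fun x => cross (u x) (v x).

Definition partial (i : 'I_3) (phi : sfield R) : sfield R :=
  fun x => 'D_(axis i) phi x.
Definition grad (phi : sfield R) : vfield R := fun x => \row_i partial i phi x.
Definition div (u : vfield R) : sfield R :=
  fun x => \sum_i partial i (cpt i u) x.
Definition curl (u : vfield R) : vfield R := fun x =>
  \row_i (partial (i + 1) (cpt (i + 2) u) x
          - partial (i + 2) (cpt (i + 1) u) x).

Definition smooth (phi : sfield R) : Prop :=
  forall s : seq 'I_3, let psi := foldr partial phi s in
  continuous psi /\ forall i x, derivable psi x (axis i).

End VectorCalculus.

Section SobolevSpaces.
Context {R : realType}.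
Variable Omega : set (R * R * R).

Definition L2 : set (sfield R) :=
  [set f | (f \_ Omega) \in Lfun (@leb3 R) 2%:E].
Definition L2v : set (vfield R) := [set u | forall i, L2 (cpt i u)].
Definition L20 : set (sfield R) :=
  [set f | L2 f /\ \int[@leb3 R]_(x in Omega) f x = 0].

Definition ips (f g : sfield R) : R :=
  \int[@leb3 R]_(x in Omega) (f x * g x).
Definition ip m n (u v : R * R * R -> 'M[R]_(m, n)) : R :=
  \int[@leb3 R]_(x in Omega) mxdot (u x) (v x).
Definition norms (f : sfield R) : R := Num.sqrt (ips f f).
Definition norm m n (u : R * R * R -> 'M[R]_(m, n)) : R := Num.sqrt (ip u u).

Definition test : set (sfield R) :=
  [set phi | [/\ smooth phi,
                 compact (closure [set x | phi x != 0]) &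
                 closure [set x | phi x != 0] `<=` Omega]].
Definition testv : set (vfield R) := [set phi | forall i, test (cpt i phi)].

Definition is_wgrad (u : sfield R) (g : vfield R) : Prop :=
  L2v g /\ forall phi, testv phi -> ip g phi = - ips u (div phi).
Definition is_wcurl (u c : vfield R) : Prop :=
  L2v c /\ forall phi, testv phi -> ip c phi = ip u (curl phi).
Definition is_wdiv (u : vfield R) (d : sfield R) : Prop :=
  L2 d /\ forall phi, test phi -> ips d phi = - ip u (grad phi).

Definition H1 : set (sfield R) :=
  [set u | L2 u /\ exists g, is_wgrad u g].

(* The distributional derivatives; weak derivatives are unique as elements of
   L^2(Omega), and one representative is selected. *)
Definition wgrad (u : sfield R) : vfield R := xget (cst 0) (is_wgrad u).
Definition wcurl (u : vfield R) : vfield R := xget (cst 0) (is_wcurl u).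
Definition wdiv (u : vfield R) : sfield R := xget (cst 0) (is_wdiv u).

(* (wjac u) i j is the derivative of the i-th component in direction j *)
Definition wjac (u : vfield R) : R * R * R -> 'M[R]_3 :=
  fun x => \matrix_(i, j) wgrad (cpt i u) x 0 j.

(* Vanishing trace, vanishing tangential trace (H0curl) and vanishing normal
   trace (H0div): each space is the closure of the smooth compactly supported
   fields in the graph norm, which for a Lipschitz domain is the kernel of the
   corresponding trace operator. *)
Definition H10 : set (sfield R) :=
  [set u | H1 u /\ forall e, 0 < e -> exists phi,
     [/\ test phi, norms (fun x => u x - phi x) < e &
         norm (fun x => wgrad u x - grad phi x) < e]].
Definition H0curl : set (vfield R) :=
  [set u | L2v u /\ exists2 c, is_wcurl u c & forall e, 0 < e -> exists phi,
     [/\ testv phi, norm (fun x => u x - phi x) < e &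
         norm (fun x => c x - curl phi x) < e]].
Definition H0div : set (vfield R) :=
  [set u | L2v u /\ exists2 d, is_wdiv u d & forall e, 0 < e -> exists phi,
     [/\ testv phi, norm (fun x => u x - phi x) < e &
         norms (fun x => d x - div phi x) < e]].
Definition H10v : set (vfield R) := [set u | forall i, H10 (cpt i u)].

(* (w . nabla) u *)
Definition convect (w u : vfield R) : vfield R :=
  fun x => \row_i \sum_j w x 0 j * wjac u x i j.
Definition Lform (w u v : vfield R) : R :=
  2^-1 * (ip (convect w u) v - ip (convect w v) u).

End SobolevSpaces.

Section Domain.
Context {R : realType}.

(* The rows of a 4 x 3 matrix are the vertices of a tetrahedron. *)
Definition nondegenerate (K : 'M[R]_(4, 3)) : Prop :=
  row_free (row_mx K (const_mx 1 : 'cV_4)).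

Definition bary (l : 'rV[R]_4) : Prop :=
  (forall i, 0 <= l 0 i) /\ \sum_i l 0 i = 1.

Definition tetra (K : 'M[R]_(4, 3)) : set (R * R * R) :=
  [set x | exists2 l, bary l & coords x = l *m K].

(* the face of K spanned by the vertices that K has in common with K' *)
Definition common_face (K K' : 'M[R]_(4, 3)) : set (R * R * R) :=
  [set x | exists l, [/\ bary l, coords x = l *m K &
     forall i, l 0 i != 0 -> exists i', row i K = row i' K']].

Definition polyhedron (Omega : set (R * R * R)) : Prop :=
  exists T : seq 'M[R]_(4, 3),
    (forall K, K \in T -> nondegenerate K) /\
    closure Omega = [set x | exists2 K, K \in T & tetra K x].

Definition contractible (Omega : set (R * R * R)) : Prop :=
  exists (c : R * R * R) (H : R * (R * R * R) -> R * R * R),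
  [/\ Omega c,
      {within [set z | 0 <= z.1 <= 1 /\ Omega z.2], continuous H},
      forall t x, 0 <= t <= 1 -> Omega x -> Omega (H (t, x)) &
      forall x, Omega x -> H (0, x) = x /\ H (1, x) = c].

(* Near each boundary point, after an orthogonal change of coordinates, Omega
   is the region below the graph of a Lipschitz function. *)
Definition lipschitz_boundary (Omega : set (R * R * R)) : Prop :=
  forall x, closure Omega x -> ~ Omega x ->
  exists (A : 'M[R]_3) (zeta : R * R -> R) (U : set (R * R * R)),
  [/\ A *m A^T = 1%:M, lipschitz zeta, nbhs x U &
      forall y, U y -> let z := coords y *m A in
        Omega y <-> z 0 2 < zeta (z 0 0, z 0 1)].

Definition lipschitz_polyhedron (Omega : set (R * R * R)) : Prop :=
  [/\ open Omega, bounded_set Omega, contractible Omega,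
      polyhedron Omega & lipschitz_boundary Omega].

Definition diam (A : set (R * R * R)) : R :=
  sup [set d | exists x y, [/\ A x, A y & d = enorm (coords x - coords y)]].

Definition contains_ball (A : set (R * R * R)) (rho : R) : Prop :=
  exists c, forall y, enorm (coords y - coords c) <= rho -> A y.

Definition triangulation (Omega : set (R * R * R)) (T : seq 'M[R]_(4, 3)) :
    Prop :=
  [/\ forall K, K \in T -> nondegenerate K,
      closure Omega = [set x | exists2 K, K \in T & tetra K x] &
      forall K K', K \in T -> K' \in T ->
        tetra K `&` tetra K' = common_face K K'].

(* Regular and quasi-uniform with constant gamma and mesh size h. *)
Definition regular_quasi_uniform (gamma h : R) (T : seq 'M[R]_(4, 3)) : Prop :=
  [/\ 0 < gamma, h = \big[Num.max/0]_(K <- T) diam (tetra K),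
      forall K, K \in T -> contains_ball (tetra K) (gamma * diam (tetra K)) &
      forall K, K \in T -> gamma * h <= diam (tetra K)].

End Domain.

Inductive edge_kind : Set := Nedelec1 | Nedelec2.
Inductive face_kind : Set := RaviartThomas | BDM.

Section FiniteElements.
Context {R : realType}.
Variables (Omega : set (R * R * R)) (T : seq 'M[R]_(4, 3)).

(* polynomials of total degree at most k *)
Definition poly3 (k : nat) : set (sfield R) :=
  [set f | exists c : nat -> nat -> nat -> R, forall x, f x =
     \sum_(a < k.+1) \sum_(b < k.+1) \sum_(d < k.+1 | (a + b + d <= k)%N)
        c a b d * (x.1.1 ^+ a * x.1.2 ^+ b * x.2 ^+ d)].
Definition poly3v (k : nat) : set (vfield R) :=
  [set u | forall i, poly3 k (cpt i u)].

(* Local spaces of the de Rham sequence that ends with the discontinuous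
   piecewise polynomials of degree k.  The face space is
     RT:  P_k^3 + x P_k                      or    BDM:  P_{k+1}^3.
   With m := edge_index, equal to k after RT and k + 1 after BDM, the edge
   space is
     first kind:  P_m^3 + x \times P_m^3     or    second kind:  P_{m+1}^3,
   preceded by Lagrange elements of degree m + 1, respectively m + 2. *)
Definition face_local (fk : face_kind) (k : nat) : set (vfield R) :=
  match fk with
  | RaviartThomas => [set u | exists a b, [/\ poly3v k a, poly3 k b &
                        forall x, u x = a x + b x *: coords x]]
  | BDM => poly3v k.+1
  end.

Definition edge_index (fk : face_kind) (k : nat) : nat :=
  match fk with RaviartThomas => k | BDM => k.+1 end.

Definition edge_local (ek : edge_kind) (m : nat) : set (vfield R) :=
  match ek with
  | Nedelec1 => [set u | exists a b, [/\ poly3v m a, poly3v m b &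
                   forall x, u x = a x + cross (coords x) (b x)]]
  | Nedelec2 => poly3v m.+1
  end.

Definition lagrange_degree (ek : edge_kind) (m : nat) : nat :=
  match ek with Nedelec1 => m.+1 | Nedelec2 => m.+2 end.

Definition piecewise U (P : set (R * R * R -> U)) : set (R * R * R -> U) :=
  [set u | forall K, K \in T ->
     exists2 p, P p & u = p %[ae (@leb3 R) in tetra K]].

Definition H0h_grad ek fk k : set (sfield R) :=
  H10 Omega `&`
  piecewise (poly3 (lagrange_degree ek (edge_index fk k))).
Definition H0h_curl ek fk k : set (vfield R) :=
  H0curl Omega `&` piecewise (edge_local ek (edge_index fk k)).
Definition H0h_div fk k : set (vfield R) :=
  H0div Omega `&` piecewise (face_local fk k).
Definition L20h k : set (sfield R) :=
  L20 Omega `&` piecewise (poly3 k).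

Local Notation "f =ae g" := (f = g %[ae (@leb3 R) in Omega]) (at level 70).

Definition exact_sequence (G : set (sfield R)) (C D : set (vfield R))
    (L : set (sfield R)) : Prop :=
  [/\ [/\ forall phi, G phi -> C (wgrad Omega phi),
          forall u, C u -> D (wcurl Omega u) &
          forall u, D u -> L (wdiv Omega u)],
      forall phi, G phi -> wgrad Omega phi =ae cst 0 -> phi =ae cst 0,
      forall u, C u -> wcurl Omega u =ae cst 0 <->
        exists2 phi, G phi & wgrad Omega phi =ae u,
      forall u, D u -> wdiv Omega u =ae cst 0 <->
        exists2 w, C w & wcurl Omega w =ae u &
      forall q, L q -> exists2 u, D u & wdiv Omega u =ae q].

(* finite-dimensional subspaces (modulo equality a.e. in Omega) *)
Definition fin_dim_subspace (U : lmodType R) (V : set (R * R * R -> U)) :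
    Prop :=
  [/\ V (cst 0),
      forall a u v, V u -> V v -> V (fun x => a *: u x + v x) &
      exists n (e : 'I_n -> R * R * R -> U), (forall i, V (e i)) /\
        forall v, V v -> exists c : 'I_n -> R,
          v =ae (fun x => \sum_i c i *: e i x)].

(* conforming finite element pair for the Stokes problem that satisfies the
   inf-sup condition with constant beta *)
Definition stable_stokes_pair (beta : R) (V : set (vfield R))
    (Q : set (sfield R)) : Prop :=
  [/\ fin_dim_subspace V /\ V `<=` H10v Omega,
      @fin_dim_subspace R^o Q /\ Q `<=` L20 Omega,
      0 < beta &
      forall q, Q q -> beta * norms Omega q <=
        sup [set a | exists v, [/\ V v, ~ (v =ae cst 0) &
               a = ips Omega (wdiv Omega v) q / norm Omega (wjac Omega v)]]].

(* V^*: the continuous linear functionals on V normed by v |-> ||nabla v|| *)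
Definition dual_space (V : set (vfield R)) : set (vfield R -> R) :=
  [set f | (forall a u v, V u -> V v ->
              f (fun x => a *: u x + v x) = a * f u + f v) /\
           exists M, forall v, V v ->
              `|f v| <= M * norm Omega (wjac Omega v)].

Definition dual_norm (V : set (vfield R)) (f : vfield R -> R) : R :=
  sup [set a | exists v, [/\ V v, ~ (v =ae cst 0) &
         a = f v / norm Omega (wjac Omega v)]].

End FiniteElements.

(* Main.v *)
Require Import Defs.
From mathcomp Require Import all_boot all_order all_algebra.
From mathcomp Require Import all_classical all_reals all_analysis.
From mathcomp Require Import measurable_realfun ring lra.

(** The theorem is obtained by testing the discrete equations with discrete
    fields that the exact sequence makes admissible.

    For the magnetic Gauss law, [div B_h] is itself an admissible [s_h], so its
    [L^2] norm vanishes.  In the second equation, [C_h := curl (j_h - sigma_h)]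
    is admissible and divergence free, so the equation says that this curl is
    orthogonal to itself; it vanishes, the second equation becomes
    [(r_h, div C_h) = 0] for all [C_h], and since [div] is onto, some [C_h] has
    divergence [r_h].  For the energy identity, the first equation is tested
    with [u_h]: the skew-symmetric convection term and the pressure term drop
    out, and the Lorentz term becomes [S |j_h|^2], because the third equation
    with [tau_h := j_h] turns [(j_h, u_h x B_h)] into [(sigma_h, j_h)], and the
    fourth one, with [k_h := j_h] and [k_h := sigma_h], gives the same value to
    [(j_h, j_h)] and [(j_h, sigma_h)] as both fields have the same curl.  The
    bound is then Young's inequality.

    The analytic point is that the weak curl and the weak gradient are chosen
    representatives, so that their linearity rests on the uniqueness of weak
    derivatives, which in general needs the density of test fields in [L^2].
    Here this density is available for free: the curl of a discrete edge field
    is a discrete face field, hence lies in [H_0(div)], and the gradient of a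
    function of [H^1_0] is by definition a limit of gradients of test functions.
    Every curl and gradient that occurs is thus an [L^2] limit of test fields
    ([test_limit]), and such a field vanishes as soon as it is orthogonal to
    all test fields ([test_limit_orthogonal]).  From this follow the additivity
    of the curl ([wcurlB]) and the fact that the Jacobian of a null field of
    [H^1_0] is null ([norm_wjac_ae0]), which is what lets [le_dual_norm] cover
    the fields that the supremum in the dual norm leaves out.

    These arguments expand inner products bilinearly, so all the fields must be
    known to be square integrable, test fields included ([test_L2]).  *)

Set Implicit Arguments.
Unset Strict Implicit.
Unset Printing Implicit Defensive.

Import Order.TTheory GRing.Theory Num.Theory.
Import numFieldNormedType.Exports.

Local Open Scope classical_set_scope.
Local Open Scope ring_scope.

(** * The inner product of square-integrable matrix fields *)

Section SquareIntegrable.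
Context {R : realType}.
Variable Omega : set (R * R * R).
Local Notation mu := (@leb3 R).
Local Notation mfield m n := (R * R * R -> 'M[R]_(m, n)).

Lemma ae_leb3S (P Q : R * R * R -> Prop) : (forall x, P x -> Q x) ->
  (\forall x \ae mu, P x) -> \forall x \ae mu, Q x.
Proof. exact: (@filterS _ _ (ae_filter_ringOfSetsType mu)). Qed.

Definition sqint {m n} (U : mfield m n) : Prop :=
  forall i j, L2 Omega (fun x => U x i j).

Lemma L2_lin a (f g : sfield R) :
  L2 Omega f -> L2 Omega g -> L2 Omega (fun x => a * f x + g x).
Proof.
move=> f2 g2; rewrite /L2 /=.
have -> : (fun x => a * f x + g x) \_ Omega = a *: (f \_ Omega) + g \_ Omega.
  apply/funext => x.
  rewrite -[RHS]/(a * (f \_ Omega) x + (g \_ Omega) x) !patchE.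
  by case: ifP => // _; rewrite mulr0 addr0.
have le12 : (1 <= 2%:E :> \bar R)%E by rewrite lee_fin ler1n.
exact: (Lfun_submod_closed mu le12).2.
Qed.

Lemma L2_sum (I : Type) (s : seq I) (f : I -> sfield R) :
  (forall i, L2 Omega (f i)) -> L2 Omega (fun x => \sum_(i <- s) f i x).
Proof.
move=> f2; elim: s => [|i s IHs].
  have le12 : (1 <= 2%:E :> \bar R)%E by rewrite lee_fin ler1n.
  have := (Lfun_addr_closed mu le12).1; rewrite /L2 /=.
  have -> // : (fun x => \sum_(i <- [::]) f i x) \_ Omega = 0.
  by apply/funext => x; rewrite patchE big_nil; case: ifP.
have := L2_lin 1 (f2 i) IHs.
by congr (L2 _ _); apply/funext => x; rewrite big_cons mul1r.
Qed.

Lemma sqint_lin {m n} a (U V : mfield m n) :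
  sqint U -> sqint V -> sqint (fun x => a *: U x + V x).
Proof.
move=> U2 V2 i j.
have := L2_lin a (U2 i j) (V2 i j).
by congr (L2 _ _); apply/funext => x; rewrite !mxE.
Qed.

(** Integrals over [Omega] are treated as integrals over the whole space of
    functions cut off outside [Omega], which are the functions that membership
    in [L^2] speaks of; the product of two of them is integrable by Hoelder. *)
Lemma integrable_mxdot {m n} (U V : mfield m n) : sqint U -> sqint V ->
  mu.-integrable setT (EFin \o (fun x => mxdot (U x) (V x)) \_ Omega).
Proof.
move=> U2 V2; apply/Lfun1_integrable.
have -> : (fun x => mxdot (U x) (V x)) \_ Omega =
    \sum_i \sum_j ((fun x => U x i j) \_ Omega \* (fun x => V x i j) \_ Omega).
  apply/funext => x; rewrite fct_sumE !patchE.
  case: ifP => xO.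
    by apply: eq_bigr => i _; rewrite fct_sumE; apply: eq_bigr => j _ /=;
      rewrite !patchE xO.
  by rewrite big1 // => i _; rewrite fct_sumE big1 // => j _ /=;
    rewrite !patchE xO mulr0.
have [L0 LD] := Lfun_addr_closed mu (lexx 1%E).
apply: (big_ind (fun f => f \in Lfun mu 1%:E)) => // i _.
apply: (big_ind (fun f => f \in Lfun mu 1%:E)) => // j _.
exact: Lfun2_mul_Lfun1 (U2 i j) (V2 i j).
Qed.

Lemma ipC {m n} (U V : mfield m n) : ip Omega U V = ip Omega V U.
Proof.
apply: eq_Rintegral => x _; apply: eq_bigr => i _.
by apply: eq_bigr => j _; rewrite mulrC.
Qed.

Lemma ip_linl {m n} a (U V W : mfield m n) : sqint U -> sqint V -> sqint W ->
  ip Omega (fun x => a *: U x + V x) W = a * ip Omega U W + ip Omega V W.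
Proof.
move=> U2 V2 W2.
have UWi := integrable_mxdot U2 W2; have VWi := integrable_mxdot V2 W2.
have -> : ip Omega (fun x => a *: U x + V x) W =
    \int[mu]_x (a * ((fun x => mxdot (U x) (W x)) \_ Omega) x
                 + ((fun x => mxdot (V x) (W x)) \_ Omega) x).
  rewrite /ip Rintegral_mkcond; apply: eq_Rintegral => x _.
  rewrite !patchE; case: ifP => _; last by rewrite mulr0 addr0.
  rewrite /mxdot mulr_sumr -big_split; apply: eq_bigr => i _.
  rewrite mulr_sumr -big_split; apply: eq_bigr => j _ /=.
  by rewrite !mxE mulrDl mulrA.
rewrite RintegralD//; last exact: (integrableZl measurableT a UWi).
by rewrite RintegralZl//; congr (_ * _ + _); rewrite -Rintegral_mkcond.
Qed.

Lemma mxdot_ge0 {m n} (A : 'M[R]_(m, n)) : 0 <= mxdot A A.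
Proof.
by apply: sumr_ge0 => i _; apply: sumr_ge0 => j _; rewrite -expr2 sqr_ge0.
Qed.

Lemma mxdot_eq0 {m n} (A : 'M[R]_(m, n)) : mxdot A A = 0 -> A = 0.
Proof.
have ge0 i j : 0 <= A i j * A i j by rewrite -expr2 sqr_ge0.
move=> /psumr_eq0P A0; apply/matrixP => i j; rewrite mxE.
have /psumr_eq0P Ai0 := A0 (fun i _ => sumr_ge0 _ (fun j _ => ge0 i j)) i isT.
by apply/eqP; rewrite -sqrf_eq0 expr2 Ai0.
Qed.

Lemma ip_ge0 {m n} (U : mfield m n) : 0 <= ip Omega U U.
Proof. by apply: Rintegral_ge0 => x _; exact: mxdot_ge0. Qed.

Lemma sqr_norm {m n} (U : mfield m n) : norm Omega U ^+ 2 = ip Omega U U.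
Proof. by rewrite sqr_sqrtr// ip_ge0. Qed.

(** The integrand is a sum of squares, hence nonnegative, so it vanishes almost
    everywhere once its integral does, and then so does each entry. *)
Lemma ip_eq0 {m n} (U : mfield m n) :
  sqint U -> ip Omega U U = 0 -> U = cst 0 %[ae mu in Omega].
Proof.
move=> U2; have Ui := integrable_mxdot U2 U2.
rewrite /ip Rintegral_mkcond /Rintegral => int0.
have mU := measurable_int _ Ui.
have abs0 :
    (\int[mu]_x `|(EFin \o (fun x => mxdot (U x) (U x)) \_ Omega) x| = 0)%E.
  transitivity (\int[mu]_x (EFin \o (fun x => mxdot (U x) (U x)) \_ Omega) x)%E.
    apply: eq_integral => x _; rewrite gee0_abs//= lee_fin patchE.
    by case: ifP => // _; exact: mxdot_ge0.
  rewrite -[LHS]fineK; last exact: integrable_fin_num.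
  by congr EFin.
have /ae_eq_integral_abs ae0 := abs0.
apply: filterS (ae0 measurableT mU) => x /(_ I) /= [Ux0] xO.
apply: mxdot_eq0; move: Ux0; rewrite patchE mem_set//.
Qed.

Lemma ae0_ip {m n} (U V : mfield m n) : sqint U -> sqint V ->
  U = cst 0 %[ae mu in Omega] -> ip Omega U V = 0.
Proof.
move=> U2 V2 U0; have UVi := integrable_mxdot U2 V2.
rewrite /ip Rintegral_mkcond /Rintegral.
rewrite (ae_eq_integral (cst 0%E)) ?integral0//.
  exact: measurable_int _ UVi.
apply: ae_leb3S U0 => x Ux0 _ /=; rewrite patchE; case: ifP => // /set_mem xO.
rewrite Ux0//; congr EFin.
by rewrite /mxdot big1// => i _; rewrite big1// => j _; rewrite mxE mul0r.
Qed.

(** Scalar functions become 1 x 1 matrix fields, so that [ips] inherits all the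
    properties of [ip]. *)
Definition mx_field (f : sfield R) : mfield 1 1 := fun x => (f x)%:M.

Lemma sqint_mx_field f : L2 Omega f -> sqint (mx_field f).
Proof.
move=> f2 i j; have := f2.
by congr (L2 _ _); apply/funext => x; rewrite /mx_field !mxE !ord1 eqxx mulr1n.
Qed.

Lemma ips_mx_field f g : ips Omega f g = ip Omega (mx_field f) (mx_field g).
Proof.
apply: eq_Rintegral => x _.
by rewrite /mxdot !big_ord1 /mx_field !mxE eqxx !mulr1n.
Qed.

End SquareIntegrable.

(** * Test functions are square integrable *)

Section TestFunctions.
Context {R : realType}.
Local Notation point3 := (R * R * R)%type.
Local Notation mu := (@leb3 R).
Local Notation leb3T :=
  (measurableTypeR R * measurableTypeR R * measurableTypeR R)%type.

(** [leb3] lives on the product of the Borel sigma-algebras of the axes; this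
    sigma-algebra contains every open set because an open set is the union of
    the boxes with rational corners that it contains, and these are countable
    in number. *)
Lemma open_measurable3 (U : set point3) :
  open U -> @measurable _ leb3T U.
Proof.
move=> oU.
pose itv (q : rat * rat) : set R := `](ratr q.1), (ratr q.2)[%classic.
pose box (q : (rat * rat) * (rat * rat) * (rat * rat)) : set leb3T :=
  (itv q.1.1 `*` itv q.1.2) `*` itv q.2.
have mbox q : measurable (box q).
  by do 2?apply: measurableX; exact: measurable_itv.
(* Boxes that stick out of U contribute the empty set, so that the union can
   range over the whole countable type of rational boxes. *)
have -> : U = \bigcup_q (if `[< box q `<=` U >] then box q else set0).
  apply/seteqP; split=> [x Ux|x [q _]]; last by case: asboolP => // qU /qU.
  have /nbhs_ballP[e /= e0 xeU] : nbhs x U by exact: open_nbhs_nbhs.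
  have near_itv (y : R) : exists q, itv q y /\ itv q `<=` ball y e.
    have /rat_in_itvoo[a] : y - e < y by rewrite ltrBlDr ltrDl.
    have /rat_in_itvoo[b] : y < y + e by rewrite ltrDl.
    rewrite !in_itv/= => /andP[yb bye] /andP[yea ay].
    exists (a, b); split=> [|z]; rewrite /itv /= !in_itv/=.
      by rewrite ay yb.
    move=> /andP[az zb]; rewrite /ball /= ltr_norml; apply/andP; split; lra.
  have [q1 [x1 q1e]] := near_itv x.1.1.
  have [q2 [x2 q2e]] := near_itv x.1.2.
  have [q3 [x3 q3e]] := near_itv x.2.
  exists (q1, q2, q3) => //; case: asboolP => [//|[]].
  by move=> y [[y1 y2] y3]; apply: xeU; split; [split|];
    [exact: q1e|exact: q2e|exact: q3e].
apply: countable_bigcupT_measurable => // q.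
by case: asboolP => // _; exact: measurable0.
Qed.

Lemma continuous_measurable3 (phi : point3 -> R) :
  continuous phi -> measurable_fun (setT : set leb3T) phi.
Proof.
move=> /continuousP cphi; apply: (measurability _ (RGenOpens.measurableE R)).
move=> _ [_ [a [b ->] <-]]; rewrite setTI; apply: open_measurable3.
exact/cphi/interval_open.
Qed.

Variable Omega : set point3.

(** A test function is measurable because it is continuous, and its square is
    dominated by a constant on a cube that contains its support. *)
Lemma test_L2 phi : test Omega phi -> L2 Omega phi.
Proof.
move=> [sm cpt sub]; have cphi : continuous phi := (sm [::]).1.
have phi0 x : ~ closure [set x | phi x != 0] x -> phi x = 0.
  by move=> nx; apply: contrapT => /eqP px; apply/nx/subset_closure.
have phiO : phi \_ Omega = phi.
  apply/funext => x; rewrite patchE; case: ifPn => //; rewrite notin_setE => nx.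
  by apply/esym/phi0 => /sub.
rewrite /L2 /= phiO.
have mphi := continuous_measurable3 cphi.
have [M M0 phiM] : exists2 M, 0 < M & forall x, `|phi x| <= M.
  have /compact_bounded/pinfty_ex_gt0[M M0 bM] :
      compact (phi @` closure [set x | phi x != 0]).
    by apply: continuous_compact => //; exact: continuous_subspaceT.
  exists M => // x; have [cx|/phi0->] := pselect (closure [set x | phi x != 0] x).
    by apply: bM; exists x.
  by rewrite normr0 ltW.
have [r r0 phir] := pinfty_ex_gt0 (compact_bounded cpt).
pose I : set R := `[(- r), r]%classic.
pose box : set leb3T := (I `*` I) `*` I.
have mI : measurable I by exact: measurable_itv.
have mbox : measurable box by do 2?apply: measurableX.
have boxP x : box x \/ phi x = 0.
  have [cx|/phi0] := pselect (closure [set x | phi x != 0] x); last by right.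
  left; have : `|x| <= r by exact: phir.
  rewrite !ge_max -!andbA => /and3P[x1 x2 x3].
  by split; [split|]; rewrite /I /= in_itv /= -ler_norml.
apply/andP; split; rewrite inE//= /finite_norm unlock /Lnorm poweR_lty//.
apply: (@le_lt_trans _ _ (\int[mu]_(x in box) (M ^+ 2)%:E)%E); last first.
  rewrite integral_cst// lte_mul_pinfty// ?lee_fin ?sqr_ge0//.
  have -> : mu box =
      (lebesgue_measure I * lebesgue_measure I * lebesgue_measure I)%E.
    apply: etrans; first by apply: product_measure1E => //; exact: measurableX.
    by congr (_ * _)%E; exact: product_measure1E.
  rewrite /I lebesgue_measure_itv/=.
  have rr : - r < r by lra.
  by rewrite lte_fin rr -EFinB -!EFinM ltry.
rewrite [leRHS]integral_mkcond; apply: ge0_le_integral => //.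
- by move=> x _; rewrite lee_fin powR_ge0.
- apply/measurable_EFinP.
  apply/(@measurableT_comp _ _ _ _ _ _ (fun x : R => x `^ 2)) => //.
  exact/measurableT_comp.
- apply/(measurable_restrictT _ _).1 => //.
- move=> x _ /=; rewrite patchE powR_mulrn//.
  case: ifPn => [_|]; first by rewrite lee_fin lerXn2r ?nnegrE ?(ltW M0).
  rewrite notin_setE; have [//|->] := boxP x.
  by rewrite normr0 expr0n.
Qed.

End TestFunctions.

(** * Operations on test functions *)

Section SmoothFields.
Context {R : realType}.
Variable Omega : set (R * R * R).

Lemma foldr_partialB (phi psi : sfield R) s : smooth phi -> smooth psi ->
  foldr partial (fun x => phi x - psi x) s =
  (fun x => foldr partial phi s x - foldr partial psi s x).
Proof.
move=> sphi spsi; elim: s => [//|i s IHs] /=; rewrite IHs.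
apply/funext => x; apply: deriveB.
  exact: (sphi s).2.
exact: (spsi s).2.
Qed.

Lemma smoothB (phi psi : sfield R) : smooth phi -> smooth psi ->
  smooth (fun x => phi x - psi x).
Proof.
move=> sphi spsi s /=; rewrite foldr_partialB//.
have [cphi dphi] := sphi s; have [cpsi dpsi] := spsi s.
split=> [x|i x]; first by apply: cvgB; [exact: cphi|exact: cpsi].
exact: (derivableB (dphi i x) (dpsi i x)).
Qed.

Lemma test_of_support (phi : sfield R) (K : set (R * R * R)) :
  smooth phi -> compact K -> closed K -> K `<=` Omega ->
  [set x | phi x != 0] `<=` K -> test Omega phi.
Proof.
move=> sphi cK clK KO sub.
have subK : closure [set x | phi x != 0] `<=` K.
  by rewrite (closure_id K).1//; exact: closure_subset.
split=> //; last exact: subset_trans subK KO.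
exact: subclosed_compact (@closed_closure _ _) cK subK.
Qed.

Lemma testB (phi psi : sfield R) : test Omega phi -> test Omega psi ->
  test Omega (fun x => phi x - psi x).
Proof.
move=> [sphi cphi subphi] [spsi cpsi subpsi].
apply: (@test_of_support _ (closure [set x | phi x != 0] `|`
                            closure [set x | psi x != 0])).
- exact: smoothB.
- exact: compactU.
- by apply: closedU; exact: closed_closure.
- by move=> x [/subphi|/subpsi].
- move=> x /= /eqP px; have [phi0|phi0] := eqVneq (phi x) 0.
    right; apply: subset_closure => /=; apply/eqP => psi0.
    by apply: px; rewrite phi0 psi0 subr0.
  by left; exact: subset_closure.
Qed.

(** Off the closed support of [phi], the function is locally zero and so is its
    derivative; hence differentiation does not enlarge the support. *)
Lemma test_partial i (phi : sfield R) :
  test Omega phi -> test Omega (partial i phi).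
Proof.
move=> [sphi cphi subphi].
apply: (@test_of_support _ (closure [set x | phi x != 0])) => //.
- by move=> s; have := sphi (rcons s i); rewrite foldr_rcons.
- exact: closed_closure.
- move=> x /= /eqP dx; apply: contrapT => nx; apply: dx.
  have near0 : \near x, phi x = cst 0 x.
    have : nbhs x (~` closure [set x | phi x != 0]).
      by apply: open_nbhs_nbhs; split => //; exact/closed_openC/closed_closure.
    apply: filterS => y ny; apply: contrapT => /eqP py.
    exact/ny/subset_closure.
  by rewrite /partial (near_eq_derive _ near0) derive_cst.
Qed.

Lemma testvB (phi psi : vfield R) : testv Omega phi -> testv Omega psi ->
  testv Omega (fun x => phi x - psi x).
Proof.
move=> tphi tpsi i; have := testB (tphi i) (tpsi i).
by congr (test _ _); apply/funext => x; rewrite /cpt !mxE.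
Qed.

Lemma testv_grad (phi : sfield R) : test Omega phi -> testv Omega (grad phi).
Proof.
move=> tphi i; have := test_partial i tphi.
by congr (test _ _); apply/funext => x; rewrite /cpt !mxE.
Qed.

Lemma testv_curl (phi : vfield R) : testv Omega phi -> testv Omega (curl phi).
Proof.
move=> tphi i.
have := testB (test_partial (i + 1) (tphi (i + 2)))
              (test_partial (i + 2) (tphi (i + 1))).
by congr (test _ _); apply/funext => x; rewrite /cpt !mxE.
Qed.

Lemma curlB (phi psi : vfield R) : testv Omega phi -> testv Omega psi ->
  curl (fun x => phi x - psi x) = (fun x => curl phi x - curl psi x).
Proof.
move=> tphi tpsi; apply/funext => x; apply/rowP => i; rewrite !mxE.
have partialB k l : partial k (cpt l (fun x => phi x - psi x)) x =
    partial k (cpt l phi) x - partial k (cpt l psi) x.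
  have -> : cpt l (fun x => phi x - psi x) = (fun x => cpt l phi x - cpt l psi x).
    by apply/funext => y; rewrite /cpt !mxE.
  have [sphi _ _] := tphi l; have [spsi _ _] := tpsi l.
  by have /(congr1 (@^~ x)) := foldr_partialB [:: k] sphi spsi.
by rewrite !partialB; ring.
Qed.

Lemma L2_div (phi : vfield R) : testv Omega phi -> L2 Omega (div phi).
Proof.
move=> tphi; have L2p i := test_L2 (test_partial i (tphi i)).
exact: L2_sum.
Qed.

Lemma testv_sqint (phi : vfield R) : testv Omega phi -> sqint Omega phi.
Proof. by move=> tphi i j; rewrite ord1; exact: test_L2 (tphi j). Qed.

End SmoothFields.

(** * Limits of test fields and uniqueness of weak derivatives *)

Section TestLimits.
Context {R : realType}.
Variable Omega : set (R * R * R).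
Local Notation mfield m n := (R * R * R -> 'M[R]_(m, n)).
Local Notation "f =ae g" := (f = g %[ae (@leb3 R) in Omega]) (at level 70).

Lemma sqintB m n (U V : mfield m n) : sqint Omega U -> sqint Omega V ->
  sqint Omega (fun x => U x - V x).
Proof.
move=> U2 V2; have := sqint_lin (-1) V2 U2.
by congr (sqint _ _); apply/funext => x; rewrite scaleN1r addrC.
Qed.

Lemma ipBl m n (U V W : mfield m n) :
  sqint Omega U -> sqint Omega V -> sqint Omega W ->
  ip Omega (fun x => U x - V x) W = ip Omega U W - ip Omega V W.
Proof.
move=> U2 V2 W2; rewrite addrC -mulN1r -ip_linl//.
by congr ip; apply/funext => x; rewrite scaleN1r addrC.
Qed.

Lemma ipBB m n (U V : mfield m n) : sqint Omega U -> sqint Omega V ->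
  ip Omega (fun x => U x - V x) (fun x => U x - V x) =
  ip Omega U U - 2 * ip Omega U V + ip Omega V V.
Proof.
move=> U2 V2; have UV2 := sqintB U2 V2.
rewrite ipBl// ipC ipBl// [X in _ - X]ipC ipBl// (ipC _ V U); ring.
Qed.

Lemma norm_ltE m n (U : mfield m n) e : 0 < e ->
  (norm Omega U < e) = (ip Omega U U < e ^+ 2).
Proof.
by move=> e0; rewrite -sqr_norm ltr_pXn2r// nnegrE ?sqrtr_ge0// ltW.
Qed.

(** The form of the triangle inequality that makes limits compatible with
    subtraction. *)
Lemma normB_lt m n (U V : mfield m n) e : sqint Omega U -> sqint Omega V ->
  norm Omega U < e / 2 -> norm Omega V < e / 2 ->
  norm Omega (fun x => U x - V x) < e.
Proof.
move=> U2 V2 Ue Ve.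
have e0 : 0 < e / 2 by apply: le_lt_trans Ue; exact: sqrtr_ge0.
have e20 : 0 < e by move: e0; lra.
rewrite norm_ltE in Ue => //; rewrite norm_ltE in Ve => //.
(* Since |U - V|^2 + |U + V|^2 = 2 |U|^2 + 2 |V|^2, it suffices that
   |U + V|^2 be nonnegative. *)
have := ip_ge0 Omega (fun x => 1 *: U x + V x).
have UV2 := sqint_lin 1 U2 V2.
rewrite ip_linl// (ipC _ U) (ipC _ V) !ip_linl// (ipC _ V U).
rewrite norm_ltE// ipBB//; move: Ue Ve; rewrite expr_div_n; lra.
Qed.

Lemma fieldBACA (U V W Z : vfield R) :
  (fun x => U x - V x - (W x - Z x)) = (fun x => U x - W x - (V x - Z x)).
Proof.
by apply/funext => x; rewrite !opprB addrACA [RHS]addrACA [- V x + _]addrC.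
Qed.

Lemma normBB_lt (U V W Z : vfield R) e :
  sqint Omega U -> sqint Omega V -> sqint Omega W -> sqint Omega Z ->
  norm Omega (fun x => U x - W x) < e / 2 ->
  norm Omega (fun x => V x - Z x) < e / 2 ->
  norm Omega (fun x => U x - V x - (W x - Z x)) < e.
Proof.
move=> U2 V2 W2 Z2 UW VZ; rewrite fieldBACA.
exact: normB_lt (sqintB U2 W2) (sqintB V2 Z2) UW VZ.
Qed.

(** The closure of the test fields in [L^2].  On an open set this is all of
    [L^2], but establishing that requires mollifiers, whereas membership of the
    fields at hand is immediate from the spaces they belong to. *)
Definition test_limit (U : vfield R) : Prop :=
  sqint Omega U /\ forall e, 0 < e ->
    exists2 phi, testv Omega phi & norm Omega (fun x => U x - phi x) < e.

Lemma test_limitB U V : test_limit U -> test_limit V ->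
  test_limit (fun x => U x - V x).
Proof.
move=> [U2 Ulim] [V2 Vlim]; split; first exact: sqintB.
move=> e e0; have e20 : 0 < e / 2 by rewrite divr_gt0.
have [phi tphi Uphi] := Ulim _ e20; have [psi tpsi Vpsi] := Vlim _ e20.
exists (fun x => phi x - psi x); first exact: testvB.
exact: normBB_lt U2 V2 (testv_sqint tphi) (testv_sqint tpsi) Uphi Vpsi.
Qed.

(** By orthogonality [|U - phi|^2 = |U|^2 + |phi|^2 >= |U|^2], so the distance
    from [U] to the test fields is [|U|]; it is also zero. *)
Lemma test_limit_orthogonal U : test_limit U ->
  (forall phi, testv Omega phi -> ip Omega U phi = 0) -> U =ae cst 0.
Proof.
move=> [U2 Ulim] Uorth; apply: ip_eq0 => //; apply: contrapT => /eqP nz.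
have U0 : 0 < ip Omega U U by rewrite lt_neqAle eq_sym nz ip_ge0.
have n0 : 0 < norm Omega U by rewrite sqrtr_gt0.
(* If U did not vanish, its own norm would be a legitimate tolerance. *)
have [phi tphi] := Ulim _ n0.
rewrite norm_ltE// sqr_norm ipBB//; last exact: testv_sqint.
by rewrite (Uorth phi)//; have := ip_ge0 Omega phi; lra.
Qed.

Lemma L2v_sqint (U : vfield R) : L2v Omega U -> sqint Omega U.
Proof. by move=> U2 i j; rewrite ord1; exact: U2. Qed.

Lemma sqint_L2v (U : vfield R) : sqint Omega U -> L2v Omega U.
Proof. by move=> U2 i; exact: U2. Qed.

Lemma H0div_test_limit u : H0div Omega u -> test_limit u.
Proof.
move=> [u2 [d _ lim]]; split; first exact: L2v_sqint.
by move=> e /lim[phi [tphi uphi _]]; exists phi.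
Qed.

Lemma is_wcurlB u v c d : L2v Omega u -> L2v Omega v ->
  is_wcurl Omega u c -> is_wcurl Omega v d ->
  is_wcurl Omega (fun x => u x - v x) (fun x => c x - d x).
Proof.
move=> /L2v_sqint u2 /L2v_sqint v2 [/L2v_sqint c2 cu] [/L2v_sqint d2 dv].
split=> [|phi tphi]; first exact/sqint_L2v/sqintB.
have phi2 := testv_sqint tphi; have cphi2 := testv_sqint (testv_curl tphi).
by rewrite !ipBl// cu// dv.
Qed.

Lemma H0curl_wcurl u : H0curl Omega u -> is_wcurl Omega u (wcurl Omega u).
Proof. by move=> [_ [c uc _]]; apply: xgetPex; exists c. Qed.

Lemma H0curlB u v : H0curl Omega u -> H0curl Omega v ->
  H0curl Omega (fun x => u x - v x).
Proof.
move=> [u2 [c uc ulim]] [v2 [d vd vlim]].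
split; first by apply: sqint_L2v; apply: sqintB; exact: L2v_sqint.
exists (fun x => c x - d x); first exact: is_wcurlB.
move: uc vd => [/L2v_sqint c2 _] [/L2v_sqint d2 _].
move: u2 v2 => /L2v_sqint u2 /L2v_sqint v2.
move=> e e0; have e20 : 0 < e / 2 by rewrite divr_gt0.
have [phi [tphi uphi cphi]] := ulim _ e20.
have [psi [tpsi vpsi dpsi]] := vlim _ e20.
exists (fun x => phi x - psi x); split; first exact: testvB.
  exact: normBB_lt u2 v2 (testv_sqint tphi) (testv_sqint tpsi) uphi vpsi.
rewrite (curlB tphi tpsi).
exact: normBB_lt c2 d2 (testv_sqint (testv_curl tphi))
  (testv_sqint (testv_curl tpsi)) cphi dpsi.
Qed.

(** Both sides are weak curls of [u - v], so their difference is orthogonal to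
    all test fields; the hypotheses make it a limit of test fields as well. *)
Lemma wcurlB u v : H0curl Omega u -> H0curl Omega v ->
  test_limit (wcurl Omega u) -> test_limit (wcurl Omega v) ->
  test_limit (wcurl Omega (fun x => u x - v x)) ->
  (fun x => wcurl Omega (fun x => u x - v x) x
            - (wcurl Omega u x - wcurl Omega v x)) =ae cst 0.
Proof.
move=> uC vC ulim vlim uvlim; have uvC := H0curlB uC vC.
have wuv := is_wcurlB uC.1 vC.1 (H0curl_wcurl uC) (H0curl_wcurl vC).
apply: test_limit_orthogonal => [|phi tphi].
  by apply: test_limitB => //; exact: test_limitB.
rewrite ipBl//; [|exact: uvlim.1|exact: (test_limitB ulim vlim).1|
  exact: testv_sqint].
by rewrite (H0curl_wcurl uvC).2// wuv.2// subrr.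
Qed.

Lemma wgrad_test_limit u : H10 Omega u -> test_limit (wgrad Omega u).
Proof.
move=> [[_ ug] lim].
have [wg _] : is_wgrad Omega u (wgrad Omega u) by exact: xgetPex.
split; first exact: L2v_sqint.
by move=> e /lim[phi [tphi _ gphi]]; exists (grad phi) => //; exact: testv_grad.
Qed.

(** The weak gradient of a null function is orthogonal to all test fields. *)
Lemma wgrad_ae0 u : H10 Omega u -> u =ae cst 0 -> wgrad Omega u =ae cst 0.
Proof.
move=> uH u0; apply: test_limit_orthogonal; first exact: wgrad_test_limit.
have [[u2 ug] _] := uH.
have [_ wg] : is_wgrad Omega u (wgrad Omega u) by exact: xgetPex.
move=> phi tphi; rewrite wg// ips_mx_field ae0_ip ?oppr0//.
- exact: sqint_mx_field.
- by apply: sqint_mx_field; exact: L2_div.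
apply: ae_leb3S u0 => x ux xO.
by rewrite /mx_field ux// /cst raddf0.
Qed.

Lemma norm_wjac_ae0 u : H10v Omega u -> u =ae cst 0 ->
  norm Omega (wjac Omega u) = 0.
Proof.
move=> uH u0; apply/eqP; rewrite sqrtr_eq0.
have wjac2 : sqint Omega (wjac Omega u).
  move=> i j; have [wg _] := wgrad_test_limit (uH i).
  by have := wg 0 j; congr (L2 _ _); apply/funext => x; rewrite mxE.
rewrite ae0_ip//.
have ae_i i : wgrad Omega (cpt i u) =ae cst 0.
  apply: wgrad_ae0 => //.
  apply: ae_leb3S u0 => x ux xO.
  by rewrite /cpt ux// mxE.
have ae_all : \forall x \ae (@leb3 R),
    forall i, Omega x -> wgrad Omega (cpt i u) x = cst 0 x.
  exact: (@filter_forall _ _ _ _ (ae_filter_ringOfSetsType (@leb3 R))).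
apply: ae_leb3S ae_all => x ux xO.
by apply/matrixP => i j; rewrite !mxE ux// mxE.
Qed.

End TestLimits.

(** * Edge elements are closed under subtraction *)

Section EdgeElements.
Context {R : realType}.
Variable T : seq 'M[R]_(4, 3).

Lemma piecewiseB (P : set (vfield R)) (u v : vfield R) :
  (forall p q, P p -> P q -> P (fun x => p x - q x)) ->
  piecewise T P u -> piecewise T P v -> piecewise T P (fun x => u x - v x).
Proof.
move=> PB uP vP K KT; have [p Pp up] := uP K KT; have [q Pq vq] := vP K KT.
exists (fun x => p x - q x); first exact: PB.
have [_ ae_and _] := ae_filter_ringOfSetsType (@leb3 R).
apply: ae_leb3S (ae_and _ _ up vq).
by move=> x [upx vqx] xK; rewrite upx// vqx.
Qed.

Lemma poly3B k (f g : sfield R) :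
  poly3 k f -> poly3 k g -> poly3 k (fun x => f x - g x).
Proof.
move=> [c fc] [d gd]; exists (fun a b e => c a b e - d a b e) => x.
rewrite fc gd -sumrB; apply: eq_bigr => a _.
rewrite -sumrB; apply: eq_bigr => b _.
by rewrite -sumrB; apply: eq_bigr => e _; rewrite mulrBl.
Qed.

Lemma poly3vB k (u v : vfield R) :
  poly3v k u -> poly3v k v -> poly3v k (fun x => u x - v x).
Proof.
move=> uk vk i; have := poly3B (uk i) (vk i).
by congr (poly3 _ _); apply/funext => x; rewrite /cpt !mxE.
Qed.

Lemma crossBr (w u v : 'rV[R]_3) : cross w (u - v) = cross w u - cross w v.
Proof. by apply/rowP => i; rewrite !mxE; ring. Qed.

Lemma edge_localB ek m (u v : vfield R) : edge_local ek m u ->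
  edge_local ek m v -> edge_local ek m (fun x => u x - v x).
Proof.
case: ek => /=; last exact: poly3vB.
move=> [a [b [am bm uab]]] [c [d [cm dm vcd]]].
exists (fun x => a x - c x), (fun x => b x - d x).
split=> [||x]; [exact: poly3vB|exact: poly3vB|].
by rewrite uab vcd crossBr opprD addrACA.
Qed.

Lemma H0h_curlB Omega ek fk k (u v : vfield R) :
  H0h_curl Omega T ek fk k u -> H0h_curl Omega T ek fk k v ->
  H0h_curl Omega T ek fk k (fun x => u x - v x).
Proof.
move=> [uH uP] [vH vP]; split; first exact: H0curlB.
by apply: piecewiseB => // p q; exact: edge_localB.
Qed.

End EdgeElements.

(** * The dual norm and the theorem *)

(** If [|nabla v| = 0], which includes all null fields [v], the continuity of
    [f] gives [f v <= 0]; otherwise [f v / |nabla v|] belongs to the set whose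
    supremum is the dual norm, and continuity also bounds that set. *)
Lemma le_dual_norm {R : realType} (Omega : set (R * R * R))
    (V : set (vfield R)) (f : vfield R -> R) (v : vfield R) :
  V `<=` H10v Omega -> dual_space Omega V f -> V v ->
  f v <= dual_norm Omega V f * norm Omega (wjac Omega v).
Proof.
move=> VH [_ [M fM]] Vv.
have fv0 : norm Omega (wjac Omega v) = 0 -> f v <= 0.
  by move=> n0; have := fM v Vv; rewrite n0 mulr0; exact/le_trans/ler_norm.
have [v0|v0] := pselect (v = cst 0 %[ae (@leb3 R) in Omega]).
  by rewrite norm_wjac_ae0 ?mulr0 ?fv0 ?norm_wjac_ae0//; exact: VH.
have [n0|n0] := eqVneq (norm Omega (wjac Omega v)) 0.
  by rewrite n0 mulr0 fv0.
have n_gt0 : 0 < norm Omega (wjac Omega v).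
  by rewrite lt_neqAle eq_sym n0 sqrtr_ge0.
rewrite -ler_pdivrMr//; apply: ub_le_sup; last by exists v.
exists `|M| => _ [w [Vw _ ->]].
have [->|w0] := eqVneq (norm Omega (wjac Omega w)) 0.
  by rewrite invr0 mulr0.
have w_gt0 : 0 < norm Omega (wjac Omega w).
  by rewrite lt_neqAle eq_sym w0 sqrtr_ge0.
rewrite ler_pdivrMr//; apply: le_trans (ler_norm _) _.
apply: le_trans (fM w Vw) _.
by apply: ler_wpM2r; [exact: ltW|exact: ler_norm].
Qed.

Theorem theorem2 (R : realType) (Omega : set (R * R * R))
  (Re Rm S : R)
  (gamma h : R) (T : seq 'M[R]_(4, 3))
  (ek : edge_kind) (fk : face_kind) (k : nat)
  (beta : R) (Vh : set (vfield R)) (Qh : set (sfield R))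
  (f : vfield R -> R)
  (u j sigma B : vfield R) (p r : sfield R) :
  let Ch := H0h_curl Omega T ek fk k in
  let Dh := H0h_div Omega T fk k in
  let Lh := L20h Omega T k in
  lipschitz_polyhedron Omega ->
  0 < Re -> 0 < Rm -> 0 < S ->
  triangulation Omega T ->
  regular_quasi_uniform gamma h T ->
  exact_sequence Omega (H0h_grad Omega T ek fk k) Ch Dh Lh ->
  stable_stokes_pair Omega beta Vh Qh ->
  dual_space Omega Vh f ->
  Vh u -> Ch j -> Ch sigma -> Dh B -> Qh p -> Lh r ->
  (forall (v kk tau C : vfield R) (q s : sfield R),
     Vh v -> Ch kk -> Ch tau -> Dh C -> Qh q -> Lh s ->
     [/\ Re^-1 * ip Omega (wjac Omega u) (wjac Omega v) + Lform Omega u u v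
           + S * ip Omega j (fcross v B) - ips Omega p (wdiv Omega v) = f v,
         S * Rm^-1 * ip Omega (wcurl Omega j) C
           - S * Rm^-1 * ip Omega (wcurl Omega sigma) C
           + ips Omega r (wdiv Omega C) = 0,
         S * Rm^-1 * ip Omega sigma tau
           - S * Rm^-1 * ip Omega (fcross u B) tau = 0,
         S * ip Omega j kk - S * Rm^-1 * ip Omega B (wcurl Omega kk) = 0 &
         - ips Omega (wdiv Omega u) q = 0 /\ ips Omega (wdiv Omega B) s = 0]) ->
  [/\ wdiv Omega B = cst 0 %[ae (@leb3 R) in Omega],
      r = cst 0 %[ae (@leb3 R) in Omega] /\
      wcurl Omega (fun x => j x - sigma x) = cst 0 %[ae (@leb3 R) in Omega],
      Re^-1 * norm Omega (wjac Omega u) ^+ 2 + S * norm Omega j ^+ 2 = f u &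
      (2 * Re)^-1 * norm Omega (wjac Omega u) ^+ 2 + S * norm Omega j ^+ 2
        <= Re / 2 * dual_norm Omega Vh f ^+ 2].

Proof.
move=> Ch Dh Lh _ Re0 Rm0 S0 _ _ [[_ CD DL] _ _ exactD surjD].
move=> [[_ VH] [_ QL2] _ _] fdual uV jC sC BD pQ rL eqs.
have SRm0 : S / Rm != 0 by rewrite mulf_neq0 ?invr_eq0 ?gt_eqF.
have sq_of_L g : Lh g -> sqint Omega (mx_field g).
  by move=> [[g2 _] _]; exact: sqint_mx_field.
have lim_of_C w : Ch w -> test_limit Omega (wcurl Omega w).
  by move=> /CD[wH _]; exact: H0div_test_limit.
have divB_sq := sq_of_L _ (DL _ BD).
(* Gauss's law: s_h := div B_h. *)
have divB0 : wdiv Omega B = cst 0 %[ae (@leb3 R) in Omega].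
  have [_ _ _ _ [_]] := eqs u j sigma B p _ uV jC sC BD pQ (DL _ BD).
  rewrite ips_mx_field => /(ip_eq0 divB_sq).
  apply: ae_leb3S => x Bx xO.
  by have /matrixP/(_ 0 0) := Bx xO; rewrite !mxE eqxx mulr1n.
(* The curl of the difference, e, and the difference of the curls, d, are a
   priori distinct representatives; they agree in all inner products. *)
pose d x := wcurl Omega j x - wcurl Omega sigma x.
pose e := wcurl Omega (fun x => j x - sigma x).
have jsC : Ch (fun x => j x - sigma x) by exact: H0h_curlB.
have j2 := lim_of_C _ jC; have s2 := lim_of_C _ sC; have e2 := lim_of_C _ jsC.
have d2 := test_limitB j2 s2.
have ip_ed W : sqint Omega W -> ip Omega e W = ip Omega d W.
  move=> W2; apply/eqP; rewrite -subr_eq0 -ipBl//; last 2 first.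
    exact: e2.1.
  exact: d2.1.
  apply/eqP/ae0_ip => //; first exact: (test_limitB e2 d2).1.
  by apply: wcurlB => //; [exact: jC.1|exact: sC.1].
have eq2 C : Dh C -> S / Rm * ip Omega d C + ips Omega r (wdiv Omega C) = 0.
  move=> CDh; have [_ + _ _ _] := eqs u j sigma C p r uV jC sC CDh pQ rL.
  rewrite ipBl ?mulrBr//; [exact: j2.1|exact: s2.1|].
  exact: (H0div_test_limit CDh.1).1.
(* C_h := e, which is divergence free as the curl of an edge field. *)
have e0 : e = cst 0 %[ae (@leb3 R) in Omega].
  have dive0 : wdiv Omega e = cst 0 %[ae (@leb3 R) in Omega].
    apply/(exactD _ (CD _ jsC)); exists (fun x => j x - sigma x) => //.
    exact: aeW.
  have re0 : ips Omega r (wdiv Omega e) = 0.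
    rewrite ips_mx_field ipC; apply: ae0_ip.
    - exact/sq_of_L/DL/CD.
    - exact: sq_of_L.
    - apply: ae_leb3S dive0 => x ex xO.
      by rewrite /mx_field ex// raddf0.
  apply: ip_eq0; first exact: e2.1.
  have /eqP := eq2 _ (CD _ jsC); rewrite -/e re0 addr0 ip_ed; last exact: e2.1.
  by rewrite mulf_eq0 (negPf SRm0) => /eqP.
have d0 W : sqint Omega W -> ip Omega d W = 0.
  by move=> W2; rewrite -ip_ed// ae0_ip//; exact: e2.1.
(* C_h is a face field with divergence r_h. *)
have r0 : r = cst 0 %[ae (@leb3 R) in Omega].
  have [C CDh divC] := surjD _ rL.
  have := eq2 _ CDh; rewrite d0; last exact: (H0div_test_limit CDh.1).1.
  rewrite mulr0 add0r ips_mx_field => rC.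
  have divCr : ip Omega (fun x => mx_field (wdiv Omega C) x - mx_field r x)
      (mx_field r) = 0.
    apply: ae0_ip; last 2 first.
    - exact: sq_of_L.
    - by apply: ae_leb3S divC => x Cx xO; rewrite /mx_field Cx// subrr.
    by apply: sqintB; [exact/sq_of_L/DL|exact: sq_of_L].
  have : ip Omega (mx_field r) (mx_field r) = 0.
    move: divCr; rewrite ipBl; [|exact/sq_of_L/DL|exact: sq_of_L|exact: sq_of_L].
    by rewrite ipC rC sub0r => /eqP; rewrite oppr_eq0 => /eqP.
  move=> /(ip_eq0 (sq_of_L _ rL)).
  apply: ae_leb3S => x rx xO.
  by have /matrixP/(_ 0 0) := rx xO; rewrite !mxE eqxx mulr1n.
(* v_h := u_h, q_h := p_h and tau_h := j_h, with both k_h := j_h and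
   k_h := sigma_h. *)
have energy :
    Re^-1 * norm Omega (wjac Omega u) ^+ 2 + S * norm Omega j ^+ 2 = f u.
  have [eqf _ eq_sj eq_jj [eq_p _]] := eqs u j j B p r uV jC jC BD pQ rL.
  have [_ _ _ eq_js _] := eqs u sigma j B p r uV sC jC BD pQ rL.
  have B2 := (H0div_test_limit BD.1).1.
  have curl_eq : ip Omega B (wcurl Omega j) = ip Omega B (wcurl Omega sigma).
    apply/eqP; rewrite -subr_eq0 !(ipC _ B) -ipBl//; [|exact: j2.1|exact: s2.1].
    by rewrite d0.
  have L0 : Lform Omega u u u = 0 by rewrite /Lform subrr mulr0.
  have p0 : ips Omega p (wdiv Omega u) = 0.
    by rewrite ips_mx_field ipC -ips_mx_field; apply/eqP; rewrite -oppr_eq0 eq_p.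
  have ju : ip Omega j (fcross u B) = ip Omega sigma j.
    apply: (mulfI SRm0); rewrite ipC.
    by move/eqP: eq_sj; rewrite subr_eq0 => /eqP.
  have jj : ip Omega j j = ip Omega sigma j.
    apply: (mulfI (lt0r_neq0 S0)); rewrite [in RHS]ipC.
    move/eqP: eq_jj; rewrite subr_eq0 => /eqP ->.
    by move/eqP: eq_js; rewrite subr_eq0 curl_eq => /eqP ->.
  by rewrite -eqf L0 p0 ju -jj !sqr_norm addr0 subr0.
split=> //.
have := le_dual_norm VH fdual uV; rewrite -energy.
set n := norm Omega (wjac Omega u); set D := dual_norm Omega Vh f => le_f.
(* Young's inequality with the weight that leaves half of the viscous term. *)
have young : D * n <= (2 * Re)^-1 * n ^+ 2 + Re / 2 * D ^+ 2.
  rewrite -subr_ge0.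
  have -> : (2 * Re)^-1 * n ^+ 2 + Re / 2 * D ^+ 2 - D * n =
      (2 * Re)^-1 * (n - Re * D) ^+ 2 by field; rewrite gt_eqF.
  by rewrite mulr_ge0 ?sqr_ge0// invr_ge0 mulr_ge0// ltW.
have half : Re^-1 = (2 * Re)^-1 + (2 * Re)^-1 by field; rewrite gt_eqF.
move: le_f; rewrite half; lra.
Qed.
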